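(* Let $\Omega\in\mathcal B(\mathbb R^n)$, let $C\subset\overline\Omega$ be a density set of $\Omega$, and let $\mathcal L^n(\Omega\cap C_{\tilde\delta})<\infty$ for some $\tilde\delta>0$. Then there exists an $\mathcal L^n$-density $\mathrm{dens}_C\in\mathrm{Dens}_C$, i.e. a density measure at $C$ on $\Omega$ with $$\liminf_{\delta\downarrow0}\frac{\mathcal L^n(A\cap\Omega\cap C_\delta)}{\mathcal L^n(\Omega\cap C_\delta)}\le\mathrm{dens}_C(A)\le\limsup_{\delta\downarrow0}\frac{\mathcal L^n(A\cap\Omega\cap C_\delta)}{\mathcal L^n(\Omega\cap C_\delta)}\qquad\text{for all }A\in\mathcal B(\Omega).$$
   Context: $\mathcal L^n$ is Lebesgue measure on $\mathbb R^n$, $\mathcal B(\Omega)$ the Borel subsets of $\Omega$. A measure on $\Omega$ means a finitely additive set function on $\mathcal B(\Omega)$ vanishing at $\emptyset$. $\mathrm{ba}(\Omega,\mathcal B(\Omega),\mathcal L^n)$ is the space of bounded real-valued finitely additive measures $\mu$ on $\mathcal B(\Omega)$ such that $\mu(A)=0$ whenever $\mathcal L^n(A)=0$. $C_\delta$ denotes the open $\delta$-neighborhood of $C$ in $\mathbb R^n$. A set $C\subset\overline\Omega$ is a density set of $\Omega$ if $C$ is nonempty and closed in $\mathbb R^n$, $\mathcal L^n(C\cap\Omega)=0$, and $\mathcal L^n(C_\delta\cap\Omega)>0$ for all $\delta>0$. $\mathrm{Dens}_C$ is the set of density measures at $C$, i.e. of all $\mu\in\mathrm{ba}(\Omega,\mathcal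 B(\Omega),\mathcal L^n)$ with $\mu\ge 0$ and $\mu(C_\delta\cap\Omega)=\mu(\Omega)=1$ for all $\delta>0$. *)

(* Defs.v *)
From HB Require Import structures.
From mathcomp Require Import all_boot all_order all_algebra.
From mathcomp Require Import all_classical all_reals all_analysis.

Set Implicit Arguments.
Unset Strict Implicit.
Unset Printing Implicit Defensive.

Import Order.TTheory GRing.Theory Num.Theory.
Import numFieldNormedType.Exports.

Local Open Scope classical_set_scope.
Local Open Scope ring_scope.

(* The n-fold product of the Lebesgue measure of R. *)
Fixpoint lebesgue_tuple (R : realType) (n : nat) : set (n.-tuple R) -> \bar R :=
  match n return set (n.-tuple R) -> \bar R with
  | 0 => \d_[tuple]
  | m.+1 => fun A =>
      (lebesgue_measure \x @lebesgue_tuple R m)%E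
        [set p : R * m.-tuple R | A [tuple of p.1 :: p.2]]
  end.

(* Meaningful on Borel sets only: [\x] integrates the measure of the sections,
   which is the product measure on the product sigma-algebra. *)
Definition lebesgue_rV (R : realType) (n : nat) (A : set 'rV[R]_n) : \bar R :=
  lebesgue_tuple [set t : n.-tuple R | A (\row_i tnth t i)].

Definition borel (R : realType) (n : nat) (A : set 'rV[R]_n) : Prop :=
  <<s [set U : set 'rV[R]_n | open U] >> A.

(* For Borel Om, these are the Borel sets of the subspace Om. *)
Definition borel_on (R : realType) (n : nat) (Om A : set 'rV[R]_n) : Prop :=
  borel A /\ A `<=` Om.

(* The library's norm on 'rV is the max norm. *)
Definition eucl_dist (R : realType) (n : nat) (x y : 'rV[R]_n) : R :=
  Num.sqrt (\sum_i (x ord0 i - y ord0 i) ^+ 2).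

Definition nbhd (R : realType) (n : nat) (C : set 'rV[R]_n) (delta : R) :
    set 'rV[R]_n :=
  [set x | exists2 y, C y & eucl_dist x y < delta].

Definition density_set (R : realType) (n : nat) (Om C : set 'rV[R]_n) : Prop :=
  [/\ C `<=` closure Om,
      C !=set0,
      closed C,
      lebesgue_rV (C `&` Om) = 0%E &
      forall delta : R, 0 < delta -> (0 < lebesgue_rV (nbhd C delta `&` Om))%E].

(* Elements of ba are functions on B(Om): here they are total functions on sets
   of which only the values on B(Om) are constrained or used. *)
Definition finitely_additive_measure (R : realType) (n : nat)
    (Om : set 'rV[R]_n) (mu : set 'rV[R]_n -> R) : Prop :=
  mu set0 = 0 /\
  forall A B, borel_on Om A -> borel_on Om B -> A `&` B = set0 ->
    mu (A `|` B) = mu A + mu B.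

Definition ba (R : realType) (n : nat) (Om : set 'rV[R]_n)
    (mu : set 'rV[R]_n -> R) : Prop :=
  [/\ finitely_additive_measure Om mu,
      exists M : R, forall A, borel_on Om A -> `|mu A| <= M &
      forall A, borel_on Om A -> lebesgue_rV A = 0%E -> mu A = 0].

Definition Dens (R : realType) (n : nat) (Om C : set 'rV[R]_n)
    (mu : set 'rV[R]_n -> R) : Prop :=
  [/\ ba Om mu,
      forall A, borel_on Om A -> 0 <= mu A &
      forall delta : R, 0 < delta -> mu (nbhd C delta `&` Om) = 1 /\ mu Om = 1].

(* Division is that of the extended reals, with conventions at 0 and +oo; for a
   density set C and small delta, the denominator is positive and, when
   Om `&` nbhd C delta has finite measure for some delta, finite. *)
Definition density_ratio (R : realType) (n : nat) (Om C A : set 'rV[R]_n)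
    (delta : R) : \bar R :=
  (lebesgue_rV (A `&` Om `&` nbhd C delta) / lebesgue_rV (Om `&` nbhd C delta))%E.

(* Main.v *)
From HB Require Import structures.
Require Import Defs.
From mathcomp Require Import all_boot all_order all_algebra.
From mathcomp Require Import all_classical all_reals all_analysis.
Import Order.TTheory GRing.Theory Num.Theory.
Import numFieldNormedType.Exports.
Local Open Scope classical_set_scope.
Local Open Scope ring_scope.

(** Fix an ultrafilter [U] on the radii that refines the filter of right
    neighbourhoods of 0, and let [dens A] be the limit along [U] of the ratios
    [lebesgue (A `&` N delta) / lebesgue (N delta)] with
    [N delta = Om `&` nbhd C delta].

    For small [delta] the denominator is positive, [C] being a density set, and
    finite, by [hfin] and monotonicity. The ratios therefore lie in [[0, 1]],
    which is compact, so the limit exists for every Borel set [A]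
    ([ultrafilter_bounded_cvg]). A limit along a filter finer than [0^'+] lies
    between the limit inferior and the limit superior along [0^'+]
    ([limf_einf_le_cvg], [cvg_le_limf_esup]). Each ratio is additive in [A], and
    so is its limit. Null sets have ratio 0, and a set containing [N delta] for
    all small [delta] has ratio 1 eventually. This argument works for
    any measure and any family of sets of positive finite measure
    ([ultrafilter_density]).

    It remains to see that [lebesgue_rV] is a measure on the Borel sets
    ([lebesgue_rV_measure]). By induction on the dimension, [lebesgue_tuple] is
    a sigma-finite measure on the product sigma-algebra of tuples. It is carried
    to row vectors by a map which is measurable because every open set is a
    countable union of boxes with rational corners
    ([measurable_open_row_of_tuple]). *)

(** * The iterated Lebesgue measure as a sigma-finite measure *)

Section sigma_finite_measure_of_measure.
Context d (T : measurableType d) (R : realType).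
Variables (m : {measure set T -> \bar R}) (sm : sigma_finite setT m).

(** The proof of sigma-finiteness is an argument so that unification can recover
    it when the canonical structure is inferred. *)
Definition as_sigma_finite of sigma_finite setT m : set T -> \bar R := m.

HB.instance Definition _ := Measure.copy (as_sigma_finite sm) (Measure.sort m).
HB.instance Definition _ :=
  Measure_isSigmaFinite.Build _ _ _ (as_sigma_finite sm) sm.

End sigma_finite_measure_of_measure.

(** The canonical structure of [pushforward] has the measurability of [f] among
    its parameters, where unification cannot find it; here it is explicit. *)
Definition image_measure d1 d2 (T1 : measurableType d1) (T2 : measurableType d2)
    (R : realType) (m : {measure set T1 -> \bar R}) (f : T1 -> T2)
    (mf : measurable_fun setT f) : {measure set T2 -> \bar R} :=
  measure_function_pushforward__canonical__measure_function_Measure m mf.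

(** The equality is one of functions on all sets, not only on the measurable
    ones: the integral that defines the next dimension is then literally a
    product measure. Sigma-finiteness is part of the induction because it makes
    the measure of a section a measurable function of the base point. *)
Lemma lebesgue_tuple_sigma_finite_measure (R : realType) (n : nat) :
  exists mu : {sigma_finite_measure set (n.-tuple (measurableTypeR R)) -> \bar R},
    @lebesgue_tuple R n = mu.
Proof.
elim: n => [|n [mu IH]].
  by exists (\d_([tuple] : 0.-tuple (measurableTypeR R))).
pose c (p : measurableTypeR R * n.-tuple (measurableTypeR R)) :=
  [the n.+1.-tuple (measurableTypeR R) of p.1 :: p.2].
have mc : measurable_fun setT c by exact: measurable_cons.
pose m : {measure set (n.+1.-tuple (measurableTypeR R)) -> \bar R} :=
  image_measure _ _ _ _ _ (@lebesgue_measure R \x mu)%E c mc.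
have sm : sigma_finite setT m.
  have /sigma_finiteP[F [FT ndF Foo]] := sigma_finiteT (@lebesgue_measure R).
  have /sigma_finiteP[G [GT ndG Goo]] := sigma_finiteT mu.
  pose u (t : n.+1.-tuple (measurableTypeR R)) := (thead t, [tuple of behead t]).
  have meas_u : measurable_fun setT u.
    apply: measurable_fun_pair; first exact: measurable_tnth.
    exact: measurable_behead.
  have cK : cancel c u by move=> [x t]; congr (_, _); exact: val_inj.
  (* [F] and [G] are nondecreasing, so the diagonal products already cover. *)
  exists (fun k => u @^-1` (F k `*` G k)) => [|k].
    apply/esym/seteqP; split => // t _.
    have [i _ Fi] : (\bigcup_i F i) (thead t) by rewrite -FT.
    have [j _ Gj] : (\bigcup_j G j) [tuple of behead t] by rewrite -GT.
    exists (maxn i j) => //; split => /=.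
    - by move: Fi; apply/subsetPset/ndF/leq_maxl.
    - by move: Gj; apply/subsetPset/ndG/leq_maxr.
  have [mF Fk] := Foo k; have [mG Gk] := Goo k; split.
    by rewrite -[X in measurable X]setTI;
      apply: meas_u => //; exact: measurableX.
  rewrite /m /= /pushforward.
  rewrite (_ : c @^-1` _ = F k `*` G k); last first.
    by apply/funext => p; exact: (congr1 (F k `*` G k) (cK p)).
  by rewrite product_measure1E// lte_mul_pinfty// ge0_fin_numE.
by exists (as_sigma_finite _ _ _ m sm); rewrite /= IH.
Qed.

(** * Lebesgue measure on the Borel sets of row vectors *)

(** In this space being measurable is, by conversion, being [borel]. *)
Definition borel_space (R : realType) (n : nat) :=
  g_sigma_algebraType [set U : set 'rV[R]_n | open U].

Definition row_of_tuple (R : realType) (n : nat)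
  (t : n.-tuple (measurableTypeR R)) : borel_space R n := \row_i tnth t i.

(** [U] is the union of the boxes with rational corners that it contains, and
    there are countably many of them. In the max norm a box around [x] whose
    corners are less than [e] away in each coordinate lies in the ball of radius
    [e], whence the union is all of [U]. *)
Lemma measurable_open_row_of_tuple (R : realType) (n : nat) (U : set 'rV[R]_n) :
  open U -> measurable (@row_of_tuple R n @^-1` U).
Proof.
move=> oU.
pose box (q : {ffun 'I_n -> rat * rat}) : set 'rV[R]_n :=
  [set x | forall i, x ord0 i \in `](ratr (q i).1), (ratr (q i).2)[].
have UE : U = \bigcup_q (if `[< box q `<=` U >] then box q else set0).
  apply/seteqP; split=> [x Ux|x [q _]]; last first.
    by case: asboolP => // qU qx; exact: qU.
  have /nbhs_ballP[e /= e0 eU] : nbhs x U by exact: open_nbhs_nbhs.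
  have rat_around i : exists q : rat * rat,
      [/\ x ord0 i - e < ratr q.1, ratr q.1 < x ord0 i,
          x ord0 i < ratr q.2 & ratr q.2 < x ord0 i + e].
    have [a] : exists a, ratr a \in `](x ord0 i - e), (x ord0 i)[.
      by apply: rat_in_itvoo; rewrite ltrBlDr ltrDl.
    have [b] : exists b, ratr b \in `](x ord0 i), (x ord0 i + e)[.
      by apply: rat_in_itvoo; rewrite ltrDl.
    by rewrite !in_itv => /andP[? ?] /andP[? ?]; exists (a, b).
  have [q qP] := choice rat_around.
  have qx : box [ffun i => q i] x.
    by move=> i; rewrite ffunE in_itv /=; have [_ -> -> _] := qP i.
  exists [ffun i => q i] => //; case: asboolP => // -[].
  move=> y yq; apply: eU; split=> // i j; rewrite ord1 /ball /= ltr_distlC.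
  have := yq j; rewrite ffunE in_itv /= => /andP[qy yq2].
  have [xq _ _ qx2] := qP j.
  by rewrite (lt_trans xq qy) (lt_trans yq2 qx2).
rewrite UE preimage_bigcup; apply: countable_bigcupT_measurable => // q.
case: ifP => _; last by rewrite preimage_set0.
rewrite (_ : _ @^-1` _ = \bigcap_(i in [set: 'I_n])
    ((tnth (T:=measurableTypeR R))^~ i @^-1`
       `](ratr (q i).1), (ratr (q i).2)[%classic)).
  apply: fin_bigcap_measurable => // i _.
  rewrite -[X in measurable X]setTI.
  by apply: measurable_tnth => //; exact: measurable_itv.
apply/seteqP; split=> t /= tq i; first by move=> _; have := tq i; rewrite mxE.
by rewrite mxE; exact: tq.
Qed.

Lemma measurable_row_of_tuple (R : realType) (n : nat) :
  measurable_fun setT (@row_of_tuple R n).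
Proof.
apply: (@measurability _ _ _ _ _ _
  [set U : set (borel_space R n) | open (U : set 'rV[R]_n)]) => //.
by move=> _ [U oU <-]; rewrite setTI; exact: measurable_open_row_of_tuple.
Qed.

Lemma lebesgue_rV_measure (R : realType) (n : nat) :
  exists mu : {measure set (borel_space R n) -> \bar R},
    @lebesgue_rV R n = mu.
Proof.
have [nu nuE] := lebesgue_tuple_sigma_finite_measure R n.
exists (image_measure _ _ _ _ _ nu _ (measurable_row_of_tuple R n)).
by rewrite /lebesgue_rV nuE.
Qed.

Lemma open_nbhd (R : realType) (n : nat) (C : set 'rV[R]_n) (delta : R) :
  open (nbhd C delta).
Proof.
have cd y : continuous (fun x : 'rV[R]_n => eucl_dist x y).
  move=> x; apply: continuous_comp; last exact: sqrt_continuous.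
  apply: continuous_big => [|i _].
    exact: add_continuous.
  move=> {}x; apply: (@continuous_comp _ _ _
    (fun z : 'rV[R]_n => z ord0 i - y ord0 i) (fun r => r ^+ 2)).
    apply: (@cvgB _ _ _ (nbhs x) _ (fun z => z ord0 i) (fun=> y ord0 i)).
      exact: coord_continuous.
    exact: cvg_cst.
  exact: exprn_continuous.
rewrite (_ : nbhd C delta = \bigcup_(y in C) [set x | eucl_dist x y < delta]).
  apply: bigcup_open => y _.
  apply: (@open_comp _ _ ((@eucl_dist R n)^~ y) [set r | r < delta]).
    by move=> x _; exact: cd.
  exact: open_lt.
by apply/seteqP; split=> [x [y]|x [y]]; exists y.
Qed.

(** * Densities from ultrafilters *)

Section ultrafilter_limits.
Context (I : topologicalType) (R : realType).
Implicit Types (F U : set_system I) (f : I -> \bar R) (g : I -> R).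

(** The image of an ultrafilter is an ultrafilter, and one that contains a
    compact set converges. *)
Lemma ultrafilter_bounded_cvg U (UU : UltraFilter U) g (a b : R) :
  (\forall i \near U, a <= g i <= b) -> cvg (g @ U).
Proof.
move=> gab.
have gU : UltraFilter (g @ U).
  split=> [|G GG gUG]; first exact: fmap_proper_filter.
  rewrite predeqE => A; split=> [GA|]; last exact: gUG.
  have [//|UAc] := in_ultra_setVsetC (g @^-1` A) UU.
  have /filter_ex[x [Ax]//] : G (A `&` ~` A).
  by apply: filterI => //; exact: gUG.
have : compact `[a, b] by exact: segment_compact.
rewrite compact_ultra => /(_ _ gU)[|l [_ gl]]; last exact: cvgP gl.
by apply: filterS gab => i; rewrite /= in_itv.
Qed.

(** Each [V] in [F] is also in [U], so [g] is eventually bounded along [U] by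
    the supremum of [f] over [V]; the limit superior is the infimum of these. *)
Lemma cvg_le_limf_esup F U (UU : ProperFilter U) f g (l : R) :
  F `<=` U -> (\forall i \near U, f i = (g i)%:E) -> g @ U --> l ->
  (l%:E <= limf_esup f F)%E.
Proof.
move=> FU fg gl; rewrite limf_esupE; apply: le_ereal_inf_tmp => _ [V FV <-].
have gV : \forall i \near U, ((g i)%:E <= ereal_sup (f @` V))%E.
  near=> i; have <- : f i = (g i)%:E by near: i.
  apply: ereal_sup_ubound; exists i => //; near: i; exact: FU.
case: (ereal_sup (f @` V)) gV => [s gs|_|/filter_ex[i]//]; last exact: leey.
by rewrite lee_fin; exact: cvgr_to_le gl _.
Unshelve. all: by end_near. Qed.

Lemma limf_einf_le_cvg F U (UU : ProperFilter U) f g (l : R) :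
  F `<=` U -> (\forall i \near U, f i = (g i)%:E) -> g @ U --> l ->
  (limf_einf f F <= l%:E)%E.
Proof.
move=> FU fg gl; rewrite /limf_einf leeNl -EFinN.
apply: (cvg_le_limf_esup _ U _ _ (\- g)) => //; last exact: cvgN.
by apply: filterS fg => i ->; rewrite EFinN.
Qed.

End ultrafilter_limits.

(** [dens A] is the limit of the share of [A] in [N i] along an ultrafilter
    finer than [F]; limits preserve the inequalities and the identities that the
    shares satisfy eventually. *)
Lemma ultrafilter_density d (T : measurableType d) (R : realType)
    (m : {measure set T -> \bar R}) (I : topologicalType) (F : set_system I)
    (FF : ProperFilter F) (N : I -> set T) :
  (\forall i \near F,
    [/\ measurable (N i), (0 < m (N i))%E & (m (N i) < +oo)%E]) ->
  exists dens : set T -> R,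
    [/\ forall A, measurable A -> 0 <= dens A <= 1,
        forall A B, measurable A -> measurable B -> A `&` B = set0 ->
          dens (A `|` B) = dens A + dens B,
        forall A, measurable A -> m A = 0%E -> dens A = 0,
        forall A, (\forall i \near F, N i `<=` A) -> dens A = 1 &
        forall A, measurable A ->
          (limf_einf (fun i => m (A `&` N i) / m (N i)) F <= (dens A)%:E
            <= limf_esup (fun i => m (A `&` N i) / m (N i)) F)%E].
Proof.
move=> FN.
have [U [UU FU]] := ultraFilterLemma FF.
have UN := FU _ FN.
pose g A i := fine (m (A `&` N i)) / fine (m (N i)).
have AN_fin A i : measurable A -> measurable (N i) -> (m (N i) < +oo)%E ->
    m (A `&` N i) \is a fin_num /\ (m (A `&` N i) <= m (N i))%E.
  move=> mA mN Noo; have mAN := measurableI _ _ mA mN.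
  have ANle : (m (A `&` N i) <= m (N i))%E by rewrite le_measure ?inE.
  by split=> //; rewrite ge0_fin_numE// (le_lt_trans ANle).
have g01 A : measurable A -> \forall i \near U, 0 <= g A i <= 1.
  move=> mA; apply: filterS UN => i [mN N0 Noo].
  have [fAN ANle] := AN_fin A i mA mN Noo.
  have fN : m (N i) \is a fin_num by rewrite ge0_fin_numE.
  have N0' : 0 < fine (m (N i)) by rewrite fine_gt0// N0.
  rewrite divr_ge0 ?fine_ge0//= ler_pdivrMr// mul1r.
  exact: fine_le.
have g_cvg A : measurable A -> g A @ U --> lim (g A @ U).
  by move=> mA; exact: (ultrafilter_bounded_cvg _ _ _ _ _ _ _ (g01 A mA)).
have ratioE A : measurable A ->
    \forall i \near U, (m (A `&` N i) / m (N i) = (g A i)%:E)%E.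
  move=> mA; apply: filterS UN => i [mN N0 Noo].
  have [fAN _] := AN_fin A i mA mN Noo.
  have fN : m (N i) \is a fin_num by rewrite ge0_fin_numE.
  have N0' : 0 < fine (m (N i)) by rewrite fine_gt0// N0.
  rewrite /g EFinM fineK//; congr (_ * _)%E.
  by rewrite -[in LHS](fineK fN) inver gt_eqF.
have lim_near A c : (\forall i \near U, g A i = c) -> lim (g A @ U) = c.
  by move=> gc; apply: norm_cvg_lim; exact: cvg_near_cst.
exists (fun A => lim (g A @ U)); split.
- move=> A mA; have gl := g_cvg A mA; have gA := g01 A mA.
  apply/andP; split.
  + apply: cvgr_to_ge gl _.
    by apply: filterS gA => i /andP[].
  + apply: cvgr_to_le gl _.
    by apply: filterS gA => i /andP[].
- move=> A B mA mB AB0; apply: norm_cvg_lim.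
  apply: cvg_trans (cvgD (g_cvg A mA) (g_cvg B mB)).
  apply: near_eq_cvg; apply: filterS UN => i [mN N0 Noo].
  have [fA _] := AN_fin A i mA mN Noo; have [fB _] := AN_fin B i mB mN Noo.
  rewrite /g setIUl measureU//.
  + by rewrite fineD// mulrDl.
  + exact: measurableI.
  + exact: measurableI.
  + by rewrite setIACA AB0 set0I.
- move=> A mA A0; apply: lim_near; apply: filterS UN => i [mN _ _].
  rewrite /g (_ : m (A `&` N i) = 0%E) ?mul0r//.
  apply/eqP; rewrite eq_le measure_ge0 andbT -A0.
  by rewrite le_measure ?inE//; exact: measurableI.
- move=> A NA; apply: lim_near; near=> i.
  have [_ N0 Noo] : [/\ measurable (N i), (0 < m (N i))%E & (m (N i) < +oo)%E].
    by near: i.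
  rewrite /g (_ : A `&` N i = N i) ?divff ?gt_eqF ?fine_gt0 ?N0//.
  apply: setIidr; near: i; exact: FU.
- move=> A mA; have gA := g_cvg A mA; have fA := ratioE A mA.
  apply/andP; split.
  + exact: limf_einf_le_cvg fA gA.
  + exact: cvg_le_limf_esup fA gA.
Unshelve. all: by end_near. Qed.

(** * The density measure at a density set *)

Lemma borel_open (R : realType) (n : nat) (U : set 'rV[R]_n) :
  open U -> borel U.
Proof. by move=> oU; exact: sub_gen_smallest. Qed.

Lemma nbhd_subset (R : realType) (n : nat) (C : set 'rV[R]_n) :
  {homo nbhd C : a b / a <= b >-> a `<=` b}.
Proof. by move=> a b ab x [y Cy xy]; exists y => //; exact: lt_le_trans ab. Qed.

Theorem corollary3p6 (R : realType) (n : nat) (Om C : set 'rV[R]_n)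
    (hOm : borel Om) (hC : density_set Om C)
    (hfin : exists2 delta : R, 0 < delta &
       (lebesgue_rV (Om `&` nbhd C delta) < +oo)%E) :
  exists2 dens : set 'rV[R]_n -> R, Dens Om C dens &
    forall A : set 'rV[R]_n, borel_on Om A ->
      (limf_einf (density_ratio Om C A) 0^'+ <= (dens A)%:E
         <= limf_esup (density_ratio Om C A) 0^'+)%E.
Proof.
have [m mE] := lebesgue_rV_measure R n.
have mOm : measurable (Om : set (borel_space R n)) := hOm.
have mN delta : measurable (Om `&` nbhd C delta : set (borel_space R n)).
  by apply: measurableI => //; apply: borel_open; exact: open_nbhd.
have [_ _ _ _ N_gt0] := hC.
have [delta0 delta0_gt0 N_fin] := hfin.
have N_ok : \forall delta \near 0^'+,
    [/\ measurable (Om `&` nbhd C delta : set (borel_space R n)),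
        (0 < m (Om `&` nbhd C delta))%E & (m (Om `&` nbhd C delta) < +oo)%E].
  near=> delta; split=> //.
    by rewrite setIC -mE; exact: N_gt0.
  rewrite -mE; apply: le_lt_trans N_fin; rewrite mE le_measure ?inE//.
  apply: setIS; apply: nbhd_subset.
  by near: delta; exact: nbhs_right_le.
have [dens [dens01 densU dens0 dens1 densE]] :=
  ultrafilter_density _ _ _ m _ _ _ _ N_ok.
exists dens; last first.
  move=> A [mA _]; have := densE A mA.
  suff -> : density_ratio Om C A =
      (fun delta => m (A `&` (Om `&` nbhd C delta)) /
        m (Om `&` nbhd C delta))%E by [].
  by apply/funext => delta; rewrite /density_ratio mE setIA.
split=> [|A [mA _]|delta delta_gt0].
- split.
  + split; first by apply: dens0; rewrite ?measure0.
    by move=> A B [mA _] [mB _]; exact: densU.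
  + exists 1 => A [mA _]; have /andP[A0 A1] := dens01 A mA.
    by rewrite ger0_norm.
  + by move=> A [mA _]; rewrite mE; exact: dens0.
- by have /andP[] := dens01 A mA.
- split; apply: dens1; near=> r.
  + rewrite setIC; apply: setSI; apply: nbhd_subset.
    by near: r; exact: nbhs_right_le.
  + exact: subIsetl.
Unshelve. all: by end_near. Qed.
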